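(* (The Nerve Criterion.) An intermediate logic $L$ is polyhedrally complete if and only if there is a class $\mathbf{D}$ of finite posets, closed under the nerve operator $\mathcal{N}$ (i.e. $F\in\mathbf{D}$ implies $\mathcal{N}(F)\in\mathbf{D}$), such that $L=\mathrm{Logic}(\mathbf{D})$.
   Context: Formulas are those of intuitionistic propositional logic. A (Kripke) frame is a poset; a formula is valid in a poset $F$ if it is true at every point under every valuation assigning upward-closed subsets to propositional variables (standard intuitionistic Kripke semantics). For a class $\mathbf{C}$ of frames (or of Heyting algebras, or of polyhedra), $\mathrm{Logic}(\mathbf{C})$ is the set of formulas valid in every member of $\mathbf{C}$. An intermediate logic is a consistent set of formulas containing intuitionistic propositional logic $\mathbf{IPC}$ and closed under modus ponens and substitution. A polytope in $\mathbb{R}^n$ is the convex hull of a finite set; a polyhedron is a finite union of polytopes; a subpolyhedron of a polyhedron $P$ is a subset of $P$ which is itself a polyhedron. An open subpolyhedron of $P$ is the complement in $P$ of a subpolyhedron of $P$. The set $\mathrm{Sub}_{\mathrm{o}}P$ of open subpolyhedra of $P$ is a Heyting subalgebra of the Heyting algebra of open subsets of $P$ (Euclidean topology). A formula $\varphi$ is valid in $P$, written $P\vDash\varphi$, if it is valid in the Heyting algebra $\mathrm{Sub}_{\mathrm{o}}P$. An intermediate logic is polyhedrally complete if it equals $\mathrm{Logic}(\mathbf{C})$ for some class $\mathbf{C}$ of polyhedra. The nerve $\mathcal{N}(F)$ of a poset $F$ is the set of finite non-empty chains of $F$ ordered by inclusion. *)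

(* Defs.v *)
From HB Require Import structures.
From mathcomp Require Import all_boot all_order all_algebra.
From mathcomp Require Import all_classical all_reals all_analysis.

Set Implicit Arguments.
Unset Strict Implicit.
Unset Printing Implicit Defensive.

Import Order.TTheory GRing.Theory Num.Theory.
Import numFieldNormedType.Exports.

Local Open Scope classical_set_scope.

(* Truth, negation and equivalence are the usual abbreviations; for instance
   the negation of A is Imp A Bot. *)
Inductive formula : Type :=
| Var of nat
| Bot
| And of formula & formula
| Or of formula & formula
| Imp of formula & formula.

Fixpoint subst (s : nat -> formula) (A : formula) : formula :=
  match A with
  | Var i => s i
  | Bot => Bot
  | And B C => And (subst s B) (subst s C)
  | Or B C => Or (subst s B) (subst s C)
  | Imp B C => Imp (subst s B) (subst s C)
  end.

Inductive ipc : formula -> Prop :=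
| ipc_K A B : ipc (Imp A (Imp B A))
| ipc_S A B C : ipc (Imp (Imp A (Imp B C)) (Imp (Imp A B) (Imp A C)))
| ipc_andl A B : ipc (Imp (And A B) A)
| ipc_andr A B : ipc (Imp (And A B) B)
| ipc_and A B : ipc (Imp A (Imp B (And A B)))
| ipc_orl A B : ipc (Imp A (Or A B))
| ipc_orr A B : ipc (Imp B (Or A B))
| ipc_or A B C : ipc (Imp (Imp A C) (Imp (Imp B C) (Imp (Or A B) C)))
| ipc_bot A : ipc (Imp Bot A)
| ipc_mp A B : ipc (Imp A B) -> ipc A -> ipc B.

Definition intermediate_logic (L : set formula) : Prop :=
  [/\ ~ L Bot,
      ipc `<=` L,
      forall A B, L (Imp A B) -> L A -> L B
    & forall s A, L A -> L (subst s A)].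

Section Kripke.
Context {d : Order.disp_t} (F : porderType d).
Local Open Scope order_scope.

Definition upward_closed (U : set F) : Prop :=
  forall x y, x <= y -> U x -> U y.

Fixpoint forces (v : nat -> set F) (x : F) (A : formula) : Prop :=
  match A with
  | Var i => v i x
  | Bot => False
  | And B C => forces v x B /\ forces v x C
  | Or B C => forces v x B \/ forces v x C
  | Imp B C => forall y, x <= y -> forces v y B -> forces v y C
  end.

Definition frame_valid (A : formula) : Prop :=
  forall v : nat -> set F, (forall i, upward_closed (v i)) ->
  forall x, forces v x A.

End Kripke.

Definition is_chain {d : Order.disp_t} (F : finPOrderType d) (A : {set F}) :=
  [forall (x | x \in A), [forall (y | y \in A), (x >=< y)%O]].

(* Every chain of a finite poset is finite. *)
Definition nerve {d : Order.disp_t} (F : finPOrderType d) : Type :=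
  {A : {set F} | is_chain A && (0 < #|A|)%N}.

Definition nerve_display : Order.disp_t := Order.Disp tt tt.

Section NerveOrder.
Context {d : Order.disp_t} (F : finPOrderType d).
Implicit Types A B C : nerve F.

Definition nerve_le A B : bool := sval A \subset sval B.

Lemma nerve_le_refl : reflexive nerve_le.
Proof. by move=> A; exact: subxx. Qed.

Lemma nerve_le_anti : antisymmetric nerve_le.
Proof. by move=> A B AB; apply/val_inj/eqP; rewrite finset.eqEsubset. Qed.

Lemma nerve_le_trans : transitive nerve_le.
Proof. by move=> B A C; exact: fintype.subset_trans. Qed.

HB.instance Definition _ := Finite.on (nerve F).
HB.instance Definition _ := SubFinite.on (nerve F).
HB.instance Definition _ := Order.Le_isPOrder.Build nerve_display (nerve F)
  nerve_le_refl nerve_le_anti nerve_le_trans.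

End NerveOrder.

(* The display d is a phantom label carrying no data about the poset. *)
Definition finposet_class := forall d : Order.disp_t, finPOrderType d -> Prop.

Definition nerve_closed (D : finposet_class) : Prop :=
  forall (d : Order.disp_t) (F : finPOrderType d), D d F -> D _ (nerve F).

Definition logic_of_finposets (D : finposet_class) : set formula :=
  [set A | forall (d : Order.disp_t) (F : finPOrderType d),
             D d F -> frame_valid F A].

Section OpenSets.
Context {T : topologicalType} (P : set T).

Definition interior_in (A : set T) : set T :=
  [set x | P x /\ within P (nbhs x) A].

Definition open_imp (U V : set T) : set T := interior_in ((P `\` U) `|` V).

(* The value of a formula in the Heyting algebra of open subsets of P, when
   all the v i are open subsets of P. *)
Fixpoint interp (v : nat -> set T) (A : formula) : set T :=
  match A with
  | Var i => v i
  | Bot => set0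
  | And B C => interp v B `&` interp v C
  | Or B C => interp v B `|` interp v C
  | Imp B C => open_imp (interp v B) (interp v C)
  end.

End OpenSets.

Section Polyhedra.
Context {R : realType} {n : nat}.
Implicit Types P Q U : set 'rV[R]_n.

Definition convex_hull (X : set 'rV[R]_n) : set 'rV[R]_n :=
  smallest (fun A => convex_set A) X.

(* The hull of no points is empty, so the empty set is a polytope. *)
Definition polytope P : Prop :=
  exists s : seq 'rV[R]_n, P = convex_hull [set` s].

Definition polyhedron P : Prop :=
  exists (k : nat) (Q : 'I_k -> set 'rV[R]_n),
    (forall i, polytope (Q i)) /\ P = \bigcup_i Q i.

Definition subpolyhedron P Q : Prop := Q `<=` P /\ polyhedron Q.

Definition open_subpolyhedron P U : Prop :=
  exists2 Q, subpolyhedron P Q & U = P `\` Q.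

(* The open subpolyhedra of P form a Heyting subalgebra of the open subsets
   of P, so a formula can be evaluated with the operations of the latter; the
   top element of both algebras is P. *)
Definition polyhedron_valid P (A : formula) : Prop :=
  forall v : nat -> set 'rV[R]_n,
    (forall i, open_subpolyhedron P (v i)) -> interp P v A = P.

End Polyhedra.

Definition polyhedron_class (R : realType) := forall n : nat, set (set 'rV[R]_n).

Definition logic_of_polyhedra (R : realType) (C : polyhedron_class R) :
    set formula :=
  [set A | forall (n : nat) (P : set 'rV[R]_n), C n P -> polyhedron_valid P A].

Definition polyhedrally_complete (R : realType) (L : set formula) : Prop :=
  exists2 C : polyhedron_class R,
    (forall (n : nat) (P : set 'rV[R]_n), C n P -> polyhedron P)
    & L = logic_of_polyhedra C.

(* Main.v *)
Require Import Defs.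
From HB Require Import structures.
From mathcomp Require Import all_boot all_order all_algebra.
From mathcomp Require Import all_classical all_reals all_analysis.
From mathcomp Require Import ring lra.

(* A polyhedron P is triangulated by a finite poset F when every point of P is
   in a unique way a convex combination, with positive coefficients, of points
   attached to a chain of F.  The map from P to the nerve of F given by these
   chains is open, so formulas valid in P are valid in F, and the valuations of
   P that are constant along the open simplices are those of the nerve of F.

   Every polyhedron is triangulated by the poset of cells of a hyperplane
   arrangement, with one point chosen in each cell.  If F triangulates P, then
   so does its nerve, with an arbitrary interior point of each simplex as
   barycenter.  Given an affine form u, choose the barycenters on the
   hyperplane u = 0 whenever u takes both signs on the simplex: no simplex of
   the subdivision is then cut by u.  Hence any valuation by open subpolyhedra,
   involving finitely many affine forms, becomes constant on the open simplices
   after finitely many nerves, which keeps the class of posets that triangulate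
   given polyhedra nerve-closed and makes nerve-closed classes sufficient. *)

Set Implicit Arguments.
Unset Strict Implicit.
Unset Printing Implicit Defensive.

Import Order.TTheory GRing.Theory Num.Theory.
Import numFieldNormedType.Exports.

Local Open Scope classical_set_scope.
Local Open Scope ring_scope.

(** * Chain decompositions in a conic complex *)

Section ChainWeight.
Context {R : realFieldType} {d : Order.disp_t} (F : finPOrderType d).
Implicit Types (W : {ffun F -> R}) (x y : F).

(** The total weight is left free, so these are the points of the cone over the order complex of
    [F], with apex the zero weight. *)
Definition chain_weight W : Prop :=
  (forall x, 0 <= W x) /\
  (forall x y, W x != 0 -> W y != 0 -> (x >=< y)%O).

Lemma chain_weight_top W : chain_weight W -> W <> [ffun=> 0] ->
  exists2 x, W x != 0 & forall y, W y != 0 -> (y <= x)%O.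
Proof.
move=> [_ Wc] Wn0.
have [x0 Wx0] : exists x, W x != 0.
  apply: contrapT => noW; apply: Wn0; apply/ffunP => x; rewrite ffunE.
  by apply/eqP; apply: contrapT => /negP Wx; apply: noW; exists x.
(* The top of the support is an element with the most elements below it: if it were below another
   [y] of the support, both would have the same down-set. *)
case: (@arg_maxnP _ x0 (fun x => W x != 0) (fun x => #|[set y | (y <= x)%O]%SET|) Wx0).
move=> x Wx xmax; exists x => // y Wy.
have /orP[//|yx] := Wc _ _ Wy Wx.
have sub : [set z | (z <= x)%O]%SET \subset [set z | (z <= y)%O]%SET.
  by apply/fintype.subsetP => z; rewrite !inE => zx; apply: le_trans yx.
have /eqP eqs : [set z | (z <= x)%O]%SET == [set z | (z <= y)%O]%SET.
  by rewrite eqEcard sub; exact: xmax.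
have : y \in [set z | (z <= y)%O]%SET by rewrite inE.
by rewrite -eqs inE.
Qed.

Lemma chain_weight_sub W W' : chain_weight W -> (forall x, 0 <= W' x) ->
  (forall x, W' x != 0 -> W x != 0) -> chain_weight W'.
Proof. by move=> [_ Wc] W'0 sub; split=> // x y /sub Wx /sub Wy; exact: Wc. Qed.

End ChainWeight.

Section ConicComplex.
Context {R : realFieldType} {V : lmodType R} {I : finType} (f : I -> V -> R).
Hypothesis f_scalar : forall i, scalar (f i).
Implicit Types (v w : V).

(** Strict signs at [v] persist at [w], so [v] lies in the closed cell of [w] in the arrangement of
    the hyperplanes [f i = 0]. *)
Definition face v w : Prop :=
  forall i, (0 < f i v -> 0 < f i w) /\ (f i v < 0 -> f i w < 0).

Lemma face_trans u v w : face u v -> face v w -> face u w.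
Proof.
by move=> uv vw i; have [a b] := uv i; have [a' b'] := vw i; split=> [/a|/b].
Qed.

Lemma form0 i : f i 0 = 0.
Proof. by have := f_scalar i (-1) 0 0; rewrite scaler0 addr0 mulN1r addNr. Qed.

Lemma face_neq0 v w i : face v w -> f i w = 0 -> f i v = 0.
Proof.
move=> /(_ i)[p q] w0; rewrite w0 ltxx in p q.
by case: (ltrgtP 0 (f i v)) => // [/p|/q].
Qed.

Lemma form_sum (J : finType) i (W : J -> R) (g : J -> V) :
  f i (\sum_s W s *: g s) = \sum_s W s * f i (g s).
Proof.
apply: (big_ind2 (fun v r => f i v = r)) => [|v a w b <- <-|s _]; first exact: form0.
- by have := f_scalar i 1 v w; rewrite scale1r mul1r.
- by have := f_scalar i (W s) (g s) 0; rewrite form0 !addr0.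
Qed.

(** [C] is a union of closed cells on which only 0 is a common zero of the forms; [G] is the poset
    of its nonzero cells, and [b] picks one point in each of them. *)
Context {d : Order.disp_t} {G : finPOrderType d} {C : set V} {b : G -> V}.
Hypothesis C0 : C 0.
Hypothesis C_face : forall v w, C w -> face v w -> C v.
Hypothesis C_pointed : forall v, C v -> (forall i, f i v = 0) -> v = 0.
Hypothesis bC : forall s, C (b s).
Hypothesis b_neq0 : forall s, b s <> 0.
Hypothesis b_le : forall s t, (s <= t)%O <-> face (b s) (b t).
Hypothesis b_onto : forall v, C v -> v <> 0 -> exists s, face v (b s) /\ face (b s) v.
Implicit Types (W : {ffun G -> R}) (s t : G).

Let comb W := \sum_s W s *: b s.

(** All points involved lie in the closed cell of [b s], so no form takes opposite signs on them,
    and the positive coefficient at [s] keeps every sign of [b s] strict. *)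
Lemma face_comb_top W s : chain_weight W -> W s != 0 ->
  (forall t, W t != 0 -> (t <= s)%O) -> face (comb W) (b s) /\ face (b s) (comb W).
Proof.
move=> [W0 _] Ws top.
have Wspos : 0 < W s by rewrite lt_def Ws W0.
have nonneg (g : G -> R) : (forall t, W t != 0 -> 0 <= g t) ->
    0 <= \sum_t W t * g t.
  move=> g0; apply: sumr_ge0 => t _.
  by have [->|/g0 ?] := eqVneq (W t) 0; rewrite ?mul0r // mulr_ge0.
have pos (g : G -> R) : (forall t, W t != 0 -> 0 <= g t) -> 0 < g s ->
    0 < \sum_t W t * g t.
  move=> g0 gs; rewrite (bigD1 s) //=; apply: ltr_pwDl; first exact: mulr_gt0.
  apply: sumr_ge0 => t _.
  by have [->|/g0 ?] := eqVneq (W t) 0; rewrite ?mul0r // mulr_ge0.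
have opp (g : G -> R) : \sum_t W t * (- g t) = - \sum_t W t * g t.
  by rewrite -sumrN; apply: eq_bigr => t _; rewrite mulrN.
have fs i t : W t != 0 -> (0 < f i (b t) -> 0 < f i (b s)) /\
    (f i (b t) < 0 -> f i (b s) < 0).
  by move=> /top /b_le /(_ i).
split=> i; rewrite form_sum; split.
- apply: contraTT; rewrite -!leNgt => bs0; rewrite -oppr_ge0 -opp //.
  apply: nonneg => t /(fs i)[p _]; rewrite oppr_ge0 leNgt.
  by apply/negP => /p; rewrite ltNge bs0.
- apply: contraTT; rewrite -!leNgt => bs0.
  apply: nonneg => t /(fs i)[_ p]; rewrite leNgt.
  by apply/negP => /p; rewrite ltNge bs0.
- move=> bs0; apply: pos => // t /(fs i)[_ p]; rewrite leNgt.
  by apply/negP => /p; rewrite ltNge (ltW bs0).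
- move=> bs0; rewrite -oppr_gt0 -opp //; apply: pos; last by rewrite oppr_gt0.
  move=> t /(fs i)[p _]; rewrite oppr_ge0 leNgt.
  by apply/negP => /p; rewrite ltNge (ltW bs0).
Qed.

Lemma comb0 : comb [ffun=> 0] = 0.
Proof. by rewrite /comb big1 // => s _; rewrite ffunE scale0r. Qed.

Lemma conic_comb W : chain_weight W -> C (comb W).
Proof.
move=> cW; have [->|/eqP Wn0] := eqVneq W [ffun=> 0]; first by rewrite comb0.
have [s Ws top] := chain_weight_top cW Wn0.
by apply: C_face (bC s) _; have [] := face_comb_top cW Ws top.
Qed.

(** After subtraction of the pointwise minimum, the two weights have disjoint supports and still the
    same combination. If both are nonzero, their tops name the same cell and coincide, against
    disjointness; if only one is, 0 would lie in the cell of some [b s]. *)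
Lemma conic_uniq W W' : chain_weight W -> chain_weight W' ->
  comb W = comb W' -> W = W'.
Proof.
move=> cW cW' eqc; pose m : {ffun G -> R} := [ffun s => Num.min (W s) (W' s)].
have [[W0 _] [W'0 _]] := (cW, cW').
pose U : {ffun G -> R} := [ffun s => W s - m s].
pose U' : {ffun G -> R} := [ffun s => W' s - m s].
have cU : chain_weight U.
  apply: (chain_weight_sub cW) => s; rewrite !ffunE.
    by rewrite subr_ge0 ge_min lexx.
  apply: contra => /eqP Ws0; rewrite Ws0 sub0r oppr_eq0; apply/eqP/min_idPl.
  exact: W'0.
have cU' : chain_weight U'.
  apply: (chain_weight_sub cW') => s; rewrite !ffunE.
    by rewrite subr_ge0 ge_min lexx orbT.
  apply: contra => /eqP Ws0; rewrite Ws0 sub0r oppr_eq0; apply/eqP/min_idPr.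
  exact: W0.
have eqU : comb U = comb U'.
  suff sub (X : {ffun G -> R}) :
      comb [ffun s => X s - m s] = comb X - comb m by rewrite !sub eqc.
  by rewrite /comb -sumrB; apply: eq_bigr => s _; rewrite ffunE scalerBl.
have disj s : U s != 0 -> U' s != 0 -> False.
  by rewrite !ffunE; case: leP => _; rewrite subrr eqxx.
have comb_n0 X s : chain_weight X -> X s != 0 ->
    (forall t, X t != 0 -> (t <= s)%O) -> comb X <> 0.
  move=> cX Xs top cX0; have [_ fc] := face_comb_top cX Xs top.
  apply: (b_neq0 (s := s)); apply: C_pointed => // i.
  by apply: face_neq0 fc _; rewrite cX0 form0.
suff [U0 U'0] : U = [ffun=> 0] /\ U' = [ffun=> 0].
  apply/ffunP => s; move/ffunP/(_ s): U0; move/ffunP/(_ s): U'0.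
  by rewrite [U' s]ffunE [U s]ffunE !ffunE => /subr0_eq e' /subr0_eq e; rewrite e.
have [U0|/eqP Un0] := eqVneq U [ffun=> 0]; have [U'0|/eqP U'n0] := eqVneq U' [ffun=> 0].
- by [].
- have [s Us top] := chain_weight_top cU' U'n0.
  by case: (comb_n0 _ _ cU' Us top); rewrite -eqU U0 comb0.
- have [s Us top] := chain_weight_top cU Un0.
  by case: (comb_n0 _ _ cU Us top); rewrite eqU U'0 comb0.
- have [s Us top] := chain_weight_top cU Un0.
  have [s' Us' top'] := chain_weight_top cU' U'n0.
  have [fs sf] := face_comb_top cU Us top.
  have [fs' sf'] := face_comb_top cU' Us' top'.
  rewrite eqU in fs sf.
  have ss' : s = s'.
    by apply: le_anti; apply/andP; split; apply/b_le;
       [exact: face_trans fs'|exact: face_trans fs].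
  by case: (disj s) => //; rewrite ss'.
Qed.

(* Subtracting the largest multiple of the point of its cell that keeps [v] in
   the closed cell moves [v] to a proper face. *)
Lemma conic_decomp v : C v -> exists2 W : {ffun G -> R}, chain_weight W & v = comb W.
Proof.
have [k] := ubnP #|[set i | f i v != 0]%SET|.
elim: k v => // k IH v; rewrite ltnS => vk Cv.
have [->|/eqP vn0] := eqVneq v 0.
  exists [ffun=> 0]; last by rewrite comb0.
  by split=> x; rewrite !ffunE // => y; rewrite eqxx.
have [s [vs sv]] := b_onto Cv vn0.
have [i0 fi0] : exists i, f i v != 0.
  apply: contrapT => no; apply: vn0; apply: C_pointed => // i; apply/eqP.
  by apply: contrapT => /negP fi; apply: no; exists i.
case: (@arg_minP _ _ _ i0 (fun i => f i v != 0) (fun i => f i v / f i (b s)) fi0).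
move=> i fi imin; set t := f i v / f i (b s) in imin.
have ratio j : f j v != 0 -> 0 < f j v / f j (b s).
  by rewrite neq_lt => /orP[fj|fj]; have [p q] := vs j;
    [rewrite ltr_ndivlMr ?q // mul0r|rewrite divr_gt0 ?p].
have fjt j : f j (v - t *: b s) = f j v - t * f j (b s).
  by rewrite [v - _]addrC -scaleNr f_scalar mulNr addrC.
pose v' := v - t *: b s.
have v'v : face v' v.
  move=> j; rewrite fjt; have [p q] := sv j; have tpos := ratio i fi.
  split=> h.
  - case: (ltrgtP (f j v) 0) => // fj; last first.
      by move: h; rewrite (face_neq0 sv fj) fj mulr0 subr0 ltxx.
    have := imin j; rewrite lt_eqF // ler_ndivlMr ?(proj2 (vs j)) // => /(_ isT).
    by move: h; rewrite subr_gt0 => /lt_le_trans h /h; rewrite ltxx.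
  - case: (ltrgtP 0 (f j v)) => // fj; last first.
      by move: h; rewrite (face_neq0 sv (esym fj)) -fj mulr0 subr0 ltxx.
    have := imin j; rewrite gt_eqF // ler_pdivlMr ?(proj1 (vs j)) // => /(_ isT).
    by move=> /le_lt_trans h'; move: h; rewrite subr_lt0 => /h'; rewrite ltxx.
have fbi : f i (b s) != 0.
  by apply: contra fi => /eqP /(face_neq0 vs) ->.
have fiv' : f i v' = 0 by rewrite fjt divfK // subrr.
have Cv' : C v' := C_face Cv v'v.
have [|W cW v'E] := IH v' _ Cv'.
  apply: leq_trans vk; apply: proper_card; apply/fintype.properP; split.
    apply/fintype.subsetP => j; rewrite !inE; apply: contra => /eqP /(face_neq0 v'v) ->.
    by rewrite eqxx.
  by exists i; rewrite !inE // fiv' eqxx.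
(* The remainder lies in the closed cell of [v], so its chain is below [s], and adding a multiple of
   [b s] keeps the support a chain. *)
have below u : W u != 0 -> (u <= s)%O.
  move=> Wu; have Wn0 : W <> [ffun=> 0] by move=> W0; rewrite W0 ffunE eqxx in Wu.
  have [r Wr top] := chain_weight_top cW Wn0.
  apply: le_trans (top _ Wu) _; apply/b_le.
  have [_ fr] := face_comb_top cW Wr top; rewrite -v'E in fr.
  exact: face_trans fr (face_trans v'v vs).
have [W0 Wc] := cW.
exists [ffun u => W u + t * (u == s)%:R].
  split=> [u|u u']; rewrite !ffunE.
    by rewrite addr_ge0 // mulr_ge0 // ltW // ratio.
  have [->|us] := eqVneq u s; have [->|u's] := eqVneq u' s; rewrite /= ?mulr0 ?addr0 //.
  - by rewrite /Order.comparable lexx.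
  - by move=> _ /below h; rewrite /Order.comparable h orbT.
  - by move=> /below h; rewrite /Order.comparable h.
  - exact: Wc.
rewrite /comb; under eq_bigr do rewrite ffunE scalerDl.
rewrite big_split /= -/(comb W) -v'E (bigD1 s) //= big1 ?addr0.
  by rewrite eqxx mulr1 subrK.
by move=> u /negPf ->; rewrite mulr0 scale0r.
Qed.

End ConicComplex.

(** * Polyhedra as unions of intersections of half-spaces *)

Section Dot.
Context {R : realFieldType} {m : nat}.
Implicit Types (u v w : 'rV[R]_m) (s ls : seq 'rV[R]_m).

Definition dot w u : R := (w *m u^T) 0 0.

Lemma dot_scalar u : scalar (dot^~ u).
Proof. by move=> a v w; rewrite /dot mulmxDl -scalemxAl !mxE. Qed.

Lemma dotC v w : dot v w = dot w v.
Proof. by rewrite /dot -[w *m _]trmxK trmx_mul trmxK [RHS]mxE. Qed.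

Lemma dotBZl v w a u : dot (v - a *: w) u = dot v u - a * dot w u.
Proof. by rewrite addrC -scaleNr dot_scalar mulNr addrC. Qed.

Lemma dot0l u : dot 0 u = 0.
Proof. by rewrite /dot mul0mx mxE. Qed.

Lemma dotZl a v u : dot (a *: v) u = a * dot v u.
Proof. by rewrite -[a *: v]addr0 dot_scalar dot0l addr0. Qed.

Lemma dotZr a v u : dot v (a *: u) = a * dot v u.
Proof. by rewrite dotC dotZl dotC. Qed.

Lemma dotNr v u : dot v (- u) = - dot v u.
Proof. by rewrite -scaleN1r dotZr mulN1r. Qed.

Lemma dot_delta w j : dot w (delta_mx 0 j) = w 0 j.
Proof. by rewrite /dot trmx_delta -colE mxE. Qed.

Lemma dot_sum (J : finType) (W : J -> R) (g : J -> 'rV[R]_m) u :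
  dot (\sum_s W s *: g s) u = \sum_s W s * dot (g s) u.
Proof. exact: (form_sum (f := fun _ : unit => dot^~ u) (fun=> dot_scalar u) tt). Qed.

Definition coord_forms : seq 'rV[R]_m := [seq delta_mx 0 j | j <- enum 'I_m].

Lemma coord_formsP w : (forall u, u \in coord_forms -> dot w u = 0) -> w = 0.
Proof.
move=> w0; apply/rowP => j; rewrite mxE -dot_delta; apply: w0.
by rewrite map_f // mem_enum.
Qed.

(** The finitely generated cone, in a recursive form that exposes one coefficient at a time for
    elimination. *)
Fixpoint cone s w : Prop :=
  if s is v :: s' then exists2 t, 0 <= t & cone s' (w - t *: v) else w = 0.

Lemma cone0 s : cone s 0.
Proof. by elim: s => //= v s IH; exists 0; rewrite ?scale0r ?subrr. Qed.

Lemma coneD s v w : cone s v -> cone s w -> cone s (v + w).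
Proof.
elim: s v w => [v w -> -> /=|u s IH v w [t t0 vt] [t' t'0 wt']]; first by rewrite addr0.
exists (t + t'); first exact: addr_ge0.
by rewrite scalerDl opprD addrACA; exact: IH.
Qed.

Lemma coneZ s a w : 0 <= a -> cone s w -> cone s (a *: w).
Proof.
move=> a0; elim: s w => [w -> /=|u s IH w [t t0 wt]]; first by rewrite scaler0.
by exists (a * t); rewrite ?mulr_ge0 // -scalerA -scalerBr; exact: IH.
Qed.

Lemma cone_mem s v : v \in s -> cone s v.
Proof.
elim: s => // u s IH; rewrite inE => /predU1P[->|/IH vs].
  by exists 1; rewrite // scale1r subrr; exact: cone0.
by exists 0; rewrite // scale0r subr0.
Qed.

Lemma seq_sup0 (r : seq R) : exists2 t, 0 <= t &
  (forall x, x \in r -> x <= t) /\ (t = 0 \/ t \in r).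
Proof.
elim: r => [|x r [t t0 [ub tr]]]; first by exists 0 => //; split; [|left].
have [xt|tx] := leP x t.
  exists t => //; split=> [y|]; first by rewrite inE => /predU1P[->|/ub].
  by case: tr => [->|tr]; [left|right; rewrite inE tr orbT].
exists x; first exact: le_trans (ltW tx).
split=> [y|]; last by right; rewrite mem_head.
by rewrite inE => /predU1P[->|/ub /le_trans ->] //; exact: ltW.
Qed.

(* Fourier-Motzkin elimination of the coefficient [t] of the first generator. *)
Lemma cone_forms s :
  exists ls, forall w, cone s w <-> (forall u, u \in ls -> 0 <= dot w u).
Proof.
elim: s => [|v s [ls IH]].
  exists (coord_forms ++ map -%R coord_forms) => w; split=> [-> u _|w0].
    by rewrite dot0l.
  apply: coord_formsP => u uc; apply/eqP; rewrite eq_le -oppr_ge0 -dotNr.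
  by rewrite !w0 // mem_cat ?uc ?map_f ?orbT.
(* Forms nonnegative at [v] are kept, since [t = 0] is the least constraint they can receive; each
   pair of a form positive and a form negative at [v] gives the positive combination that vanishes
   at [v]. *)
exists ([seq u <- ls | 0 <= dot v u] ++
  [seq dot v u *: u' - dot v u' *: u | u <- [seq u <- ls | 0 < dot v u],
                                      u' <- [seq u <- ls | dot v u < 0]]) => w.
split=> [[t t0 /IH wt] u|w0].
  rewrite mem_cat mem_filter => /orP[/andP[vu /wt]|/allpairsP[[p q] /=]].
    by rewrite dotBZl subr_ge0; apply: le_trans; exact: mulr_ge0.
  rewrite !mem_filter => -[/andP[vp /wt wp] /andP[vq /wt wq] ->].
  rewrite dotBZl in wp; rewrite dotBZl in wq.
  rewrite dotC dotBZl dotZl ![dot _ w]dotC.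
  have := mulr_ge0 (ltW vp) wq; have : 0 <= (- dot v q) * (dot w p - t * dot v p).
    by rewrite mulr_ge0 // oppr_ge0 ltW.
  by nra.
(* Forms negative at [v] bound [t] from below; [t] is the largest of these bounds and 0. *)
have [t t0 [tub tin]] := seq_sup0 [seq dot w u / dot v u | u <- ls & dot v u < 0].
exists t => //; apply/IH => u uls; rewrite dotBZl subr_ge0.
have [vu|vu|vu] := ltrgtP (dot v u) 0.
- by rewrite -ler_ndivrMr //; apply: tub; rewrite (map_f (fun u => _)) ?mem_filter ?vu.
- rewrite -ler_pdivlMr //; case: tin => [->|/mapP[u']].
    by apply: divr_ge0; [rewrite w0 // mem_cat mem_filter uls ltW|exact: ltW].
  rewrite mem_filter => /andP[vu' u'ls] ->.
  rewrite ler_ndivrMr // mulrAC ler_pdivrMr // -subr_ge0.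
  have : 0 <= dot w (dot v u *: u' - dot v u' *: u).
    rewrite w0 // mem_cat; apply/orP; right; apply/allpairsP; exists (u, u') => /=.
    by rewrite !mem_filter vu vu'.
  by rewrite dotC dotBZl dotZl ![dot _ w]dotC [_ * dot v u]mulrC [_ * dot v u']mulrC.
- by rewrite vu mulr0 w0 // mem_cat mem_filter uls vu lexx.
Qed.

End Dot.

Section Polyhedra.
Context {R : realType} {n : nat}.
Implicit Types (x y z : 'rV[R]_n) (w : 'rV[R]_(1 + n)) (P Q : set 'rV[R]_n).

(** With the space placed at height one, affine forms become linear forms and polytopes become
    finitely generated cones. *)
Definition homog x : 'rV[R]_(1 + n) := row_mx 1%:M x.

Definition hcone Q w : Prop :=
  w = 0 \/ exists2 a : R, 0 < a & exists2 x, Q x & w = a *: homog x.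

Lemma homog0 x : homog x 0 0 = 1.
Proof.
have -> : 0 = lshift n (0 : 'I_1) by exact: val_inj.
by rewrite row_mxEl mxE.
Qed.

Lemma homogZ0 a x : (a *: homog x) 0 0 = a.
Proof. by rewrite mxE homog0 mulr1. Qed.

Lemma homogZ_inj a b x y : a *: homog x = b *: homog y -> a = b /\ (0 < a -> x = y).
Proof.
move=> e; have ab : a = b.
  by move/rowP/(_ 0): e; rewrite !homogZ0.
split=> // a0; move: e; rewrite -ab => /(scalerI (lt0r_neq0 a0)).
by move/eq_row_mx => [].
Qed.

Lemma homog_conv (a b : R) x y : a + b = 1 ->
  a *: homog x + b *: homog y = homog (a *: x + b *: y).
Proof. by move=> ab; rewrite !scale_row_mx add_row_mx -scalerDl ab scale1r. Qed.

Lemma homog_sum (J : finType) (W : J -> R) (g : J -> 'rV[R]_n) : \sum_s W s = 1 ->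
  homog (\sum_s W s *: g s) = \sum_s W s *: homog (g s).
Proof.
move=> W1; rewrite /homog; under [RHS]eq_bigr do rewrite scale_row_mx.
apply/rowP => i; rewrite summxE; case: (split_ordP i) => j ->.
  rewrite row_mxEl; under eq_bigr do rewrite row_mxEl mxE.
  by rewrite -mulr_suml W1 mul1r.
by rewrite row_mxEr; under [RHS]eq_bigr do rewrite row_mxEr; rewrite summxE.
Qed.

Lemma homog_sum_coord (J : finType) (W : J -> R) (g : J -> 'rV[R]_n) :
  (\sum_s W s *: homog (g s)) 0 0 = \sum_s W s.
Proof.
by rewrite summxE; apply: eq_bigr => s _; rewrite homogZ0.
Qed.

Lemma cone_hull (s : seq 'rV[R]_n) w : cone (map homog s) w ->
  hcone (convex_hull [set` s]) w.
Proof.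
elim: s w => [w ->|v s IH w [t t0 /IH wt]]; first by left.
have vh : convex_hull [set` v :: s] v.
  by move=> A [_ sA]; apply: sA; rewrite /= inE eqxx.
have hs x : convex_hull [set` s] x -> convex_hull [set` v :: s] x.
  move=> xs A [cA sA]; apply: xs; split=> // y /= ys.
  by apply: sA; rewrite /= inE ys orbT.
case: wt => [/subr0_eq ->|[a a0 [x /hs xs /eqP]]].
  have [->|t_neq0] := eqVneq t 0; first by left; rewrite scale0r.
  by right; exists t; [rewrite lt_def t_neq0|exists v].
rewrite subr_eq => /eqP ->; right.
have ta : 0 < t + a by rewrite ltr_wpDl.
exists (t + a) => //; exists ((t / (t + a)) *: v + (a / (t + a)) *: x).
  move=> A [cA sA]; have [->|t_neq0] := eqVneq t 0.
    by rewrite mul0r scale0r !add0r divff ?gt_eqF // scale1r; exact: xs.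
  have tp : 0 < t by rewrite lt_def t_neq0.
  have t01 : 0 <= t / (t + a) <= 1.
    by rewrite divr_ge0 ?(ltW ta) //= ler_pdivrMr // mul1r lerDl ltW.
  have -> : a / (t + a) = 1 - t / (t + a) by field; rewrite gt_eqF.
  have vA : v \in (A : set (convex_lmodType _)) by apply: mem_set; exact: vh.
  have xA : x \in (A : set (convex_lmodType _)) by apply: mem_set; exact: xs.
  have /andP[t0' t1] := t01.
  exact: (set_mem (cA _ _ (Itv01 t0' t1) vA xA)).
rewrite -homog_conv; last by rewrite -mulrDl divff // gt_eqF.
rewrite scalerDr !scalerA addrC; congr (_ *: _ + _ *: _).
  by rewrite mulrC divfK // gt_eqF.
by rewrite mulrC divfK // gt_eqF.
Qed.

Lemma hull_cone (s : seq 'rV[R]_n) x : convex_hull [set` s] x ->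
  cone (map homog s) (homog x).
Proof.
move=> xs; have := xs [set y | cone (map homog s) (homog y)]; apply; split.
  move=> y z t /set_mem /= cy /set_mem /= cz; apply/mem_set => /=.
  have t1 : 0 <= 1 - t%:num by rewrite subr_ge0.
  suff : cone (map homog s) (t%:num *: homog y + (1 - t%:num) *: homog z).
    by rewrite homog_conv // addrC subrK.
  by apply: coneD; apply: coneZ.
by move=> y ys; apply: cone_mem; rewrite map_f.
Qed.

Lemma convex_hullP (s : seq 'rV[R]_n) x :
  convex_hull [set` s] x <-> cone (map homog s) (homog x).
Proof.
split; first exact: hull_cone.
case/cone_hull => [/rowP/(_ 0)|[a a0 [y ys]]].
  by rewrite homog0 mxE => /eqP; rewrite oner_eq0.
rewrite -[homog x]scale1r => /homogZ_inj[_ /(_ ltr01) ->] //.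
Qed.

Lemma hcone_hull (s : seq 'rV[R]_n) w :
  hcone (convex_hull [set` s]) w <-> cone (map homog s) w.
Proof.
split; last exact: cone_hull.
case=> [->|[a a0 [x /hull_cone xs ->]]]; first exact: cone0.
by apply: coneZ; rewrite ?ltW.
Qed.

(** The relation [face], for the forms of a list. *)
Definition below (ls : seq 'rV[R]_(1 + n)) (v w : 'rV[R]_(1 + n)) : Prop :=
  forall u, u \in ls -> (0 < dot v u -> 0 < dot w u) /\ (dot v u < 0 -> dot w u < 0).

(** The cone over each polytope is cut out by finitely many inequalities; with all these forms
    collected, it is closed under faces. The coordinate forms are added for the apex, whose only
    face is then itself. *)
Lemma polyhedron_forms Q : polyhedron Q -> exists ls,
  forall v w, below ls v w -> hcone Q w -> hcone Q v.
Proof.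
move=> [k [T [Tpoly ->]]].
have ex i : exists ls : seq 'rV[R]_(1 + n), forall w, hcone (T i) w <->
    (forall u, u \in ls -> 0 <= dot w u).
  have [s ->] := Tpoly i; have [ls lsP] := cone_forms (map homog s).
  by exists ls => w; rewrite -lsP; exact: hcone_hull.
have [ls lsP] := choice ex.
exists (coord_forms ++ flatten [seq ls i | i <- enum 'I_k]) => v w vw wQ.
have [w0|/eqP wn0] := eqVneq w 0.
  left; apply: coord_formsP => u uc; have [] := vw u; first by rewrite mem_cat uc.
  by rewrite w0 dot0l ltxx; case: (ltrgtP 0 (dot v u)) => // _ p q; [have := p isT|have := q isT].
have [i wi] : exists i, hcone (T i) w.
  by case: wQ => [//|[a a0 [x [i _ Tx] ->]]]; exists i; right; exists a => //; exists x.
have : hcone (T i) v.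
  apply/lsP => u ui; rewrite leNgt; apply/negP => vu.
  have [|_ /(_ vu)] := vw u; last by rewrite ltNge (proj1 (lsP i w) wi).
  rewrite mem_cat; apply/orP; right; apply/flattenP; exists (ls i) => //.
  by rewrite map_f ?mem_enum.
by case=> [->|[a a0 [x Tx ->]]]; [left|right; exists a => //; exists x => //; exists i].
Qed.

Lemma hcone_homog Q x : hcone Q (homog x) <-> Q x.
Proof.
split=> [[/rowP/(_ 0)|[a a0 [y Qy]]]|Qx].
- by rewrite homog0 mxE => /eqP; rewrite oner_eq0.
- by rewrite -[homog x]scale1r => /homogZ_inj[_ /(_ ltr01) ->].
- by right; exists 1 => //; exists x; rewrite ?scale1r.
Qed.

Lemma dot_homog_continuous u : continuous (fun x => dot (homog x) u).
Proof.
have -> : (fun x => dot (homog x) u) =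
    (fun x => u 0 (lshift n 0) + \sum_j x 0 j * u 0 (rshift 1 j)).
  apply/funext => x; rewrite /dot /homog mxE big_split_ord /= big_ord1.
  rewrite row_mxEl !mxE mul1r; congr (_ + _); apply: eq_bigr => j _.
  by rewrite row_mxEr mxE.
have sc : continuous (fun x : 'rV[R]_n => \sum_j x 0 j * u 0 (rshift 1 j)).
  apply: continuous_big => [|j _ x]; first exact: add_continuous.
  have cj := @coord_continuous R 1 n 0 j x.
  exact: cvgM cj (cvg_cst _).
by move=> x; exact: cvgD (cvg_cst _) (sc x).
Qed.

(** Only strict inequalities at [x] have to persist, and each is an open condition. *)
Lemma near_below ls x : \forall y \near x, below ls (homog x) (homog y).
Proof.
elim: ls => [|u ls IH]; first by near=> y.
have cu : (fun y => dot (homog y) u) @ x --> dot (homog x) u by exact: dot_homog_continuous.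
have cu0 : \forall y \near x, (0 < dot (homog x) u -> 0 < dot (homog y) u) /\
    (dot (homog x) u < 0 -> dot (homog y) u < 0).
  have [xu|xu|_] := ltrgtP (dot (homog x) u) 0; last by near=> y.
  - by apply: filterS (cvgr_lt _ cu _ xu) => y yu; split.
  - by apply: filterS (cvgr_gt _ cu _ xu) => y yu; split.
apply: filterS2 cu0 IH => y yu yls v.
by rewrite inE => /predU1P[->|/yls].
Unshelve. all: by end_near.
Qed.

Lemma near_segment x z N : nbhs x N ->
  exists2 e : R, 0 < e < 1 & N ((1 - e) *: x + e *: z).
Proof.
move=> Nx.
have cvx : (fun e : R => (1 - e) *: x + e *: z) @ (0 : R) --> x.
  rewrite -[X in _ --> X](_ : (1 - 0 : R) *: x + (0 : R) *: z = x); last first.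
    by rewrite subr0 scale1r scale0r addr0.
  apply: cvgD; apply: cvgZl; last exact: cvg_id.
  by apply: cvgB; [exact: cvg_cst|exact: cvg_id].
have /nbhs_ballP[r /= r0 rN] := cvx N Nx.
exists (Num.min (r / 2) (1 / 2)).
  by rewrite lt_min gt_min; apply/andP; split; [lra|apply/orP; right; lra].
apply: rN; rewrite /ball /= sub0r normrN gtr0_norm; last by rewrite lt_min; lra.
by rewrite gt_min; apply/orP; left; lra.
Qed.

End Polyhedra.

(** * Triangulations *)

(** Give weight 1 to each point of [A], let [c] be the resulting sum of [l], then add weight [k] at
    a point [z] where [l] has the sign that brings the sum to 0, and normalize. With [l] the values
    of an affine form at the vertices, this is the barycenter lying on its hyperplane. *)
Lemma balanced_weight (R : realFieldType) (T : finType) (A : {set T}) (l : T -> R) :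
  A != finset.set0 -> exists b : {ffun T -> R},
  [/\ forall x, x \in A -> 0 < b x, forall x, x \notin A -> b x = 0, \sum_x b x = 1
    & forall p q, p \in A -> q \in A -> 0 < l p -> l q < 0 -> \sum_x b x * l x = 0].
Proof.
move=> /finset.set0Pn[a aA]; pose c := \sum_(x in A) l x.
have [z zA [k k0 ck]] : exists2 z, z \in A & exists2 k, 0 <= k &
    forall p q, p \in A -> q \in A -> 0 < l p -> l q < 0 -> c + k * l z = 0.
  have [[p [q [pA qA lp lq]]]|no] := pselect (exists p q,
      [/\ p \in A, q \in A, 0 < l p & l q < 0]); last first.
    by exists a => //; exists 0 => // p q pA qA lp lq; case: no; exists p, q.
  have [c0|c0] := leP c 0.
    exists p => //; exists (- c / l p); first by rewrite divr_ge0 ?oppr_ge0 // ltW.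
    by move=> *; rewrite divfK ?subrr // gt_eqF.
  exists q => //; exists (- c / l q); first by rewrite mulr_le0 ?invr_le0 ?oppr_le0 // ltW.
  by move=> *; rewrite divfK ?subrr // lt_eqF.
pose e x : R := (x \in A)%:R + k * (x == z)%:R.
have e0 x : x \in A -> 0 < e x.
  by move=> xA; rewrite /e xA ltr_wpDr // mulr_ge0 // ler0n.
have eN x : x \notin A -> e x = 0.
  move=> xA; rewrite /e (negPf xA) (_ : (x == z) = false) ?mulr0 ?addr0 //.
  by apply: contraNF xA => /eqP ->.
have S0 : 0 < \sum_x e x.
  rewrite (bigD1 a) //= ltr_pwDl ?e0 //; apply: sumr_ge0 => x _.
  by have [/e0/ltW|/eN ->] := boolP (x \in A).
exists [ffun x => e x / \sum_x e x]; split=> [x xA|x xA||p q pA qA lp lq].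
- by rewrite ffunE divr_gt0 // e0.
- by rewrite ffunE eN // mul0r.
- by under eq_bigr do rewrite ffunE; rewrite -mulr_suml divff // gt_eqF.
under eq_bigr do rewrite ffunE mulrAC.
rewrite -mulr_suml; apply/eqP; rewrite mulf_eq0; apply/orP; left; apply/eqP.
rewrite -[RHS](ck p q) // /e; under eq_bigr do rewrite mulrDl.
rewrite big_split /=; congr (_ + _).
  by rewrite [RHS]big_mkcond; apply: eq_bigr => x _; case: ifP; rewrite ?mul1r ?mul0r.
rewrite (bigD1 z) //= eqxx mulr1 big1 ?addr0 // => x /negPf ->.
by rewrite mulr0 mul0r.
Qed.

(** The relation and its laws are parameters of the type, so that the order structure can be
    inferred from the type alone. *)
Definition poset_of (T : finType) (r : rel T) (rr : reflexive r) (ra : antisymmetric r)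
  (rt : transitive r) : Type := T.

HB.instance Definition _ T r rr ra rt := Finite.on (@poset_of T r rr ra rt).
HB.instance Definition _ T r rr ra rt :=
  Order.Le_isPOrder.Build (Order.Disp tt tt) (@poset_of T r rr ra rt) rr ra rt.

Section Realization.
Context {R : realType} {n : nat}.
Implicit Types (P : set 'rV[R]_n) (u : 'rV[R]_(1 + n)).

(** The affine extension of [g] to the geometric realization of the order complex of [F] is a
    bijection onto [P]. *)
Definition realizes {d} (F : finPOrderType d) (g : F -> 'rV[R]_n) P : Prop :=
  [/\ forall W : {ffun F -> R}, chain_weight W -> \sum_x W x = 1 ->
        P (\sum_x W x *: g x),
      forall y, P y -> exists W : {ffun F -> R},
        [/\ chain_weight W, \sum_x W x = 1 & y = \sum_x W x *: g x]
    & forall W W' : {ffun F -> R}, chain_weight W -> chain_weight W' ->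
        \sum_x W x = 1 -> \sum_x W' x = 1 ->
        \sum_x W x *: g x = \sum_x W' x *: g x -> W = W'].

(* No simplex spanned by the image of a chain has points strictly on both sides
   of [u = 0]. *)
Definition compat u {d} (F : finPOrderType d) (g : F -> 'rV[R]_n) : Prop :=
  forall s t : F, (s <= t)%O -> 0 <= dot (homog (g s)) u * dot (homog (g t)) u.

Lemma realizes_standard {d} (F : finPOrderType d) (g : F -> 'rV[R]_n) :
  (forall W W' : F -> R, \sum_x W x *: g x = \sum_x W' x *: g x -> W =1 W') ->
  realizes g [set y | exists W : {ffun F -> R},
        [/\ chain_weight W, \sum_x W x = 1 & y = \sum_x W x *: g x]].
Proof.
move=> g_free; split=> // [W cW W1|W W' _ _ _ _ /g_free WW']; first by exists W.
exact/ffunP.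
Qed.

Lemma mem_nerve_comparable {d} (F : finPOrderType d) (A : nerve F) x y :
  x \in sval A -> y \in sval A -> (x >=< y)%O.
Proof.
by case: A => A /= /andP[/forall_inP cA _] xA yA; have /forall_inP := cA x xA; apply.
Qed.

Lemma nerve_neq0 {d} (F : finPOrderType d) (A : nerve F) : sval A != finset.set0.
Proof. by case: A => A /= /andP[_]; rewrite card_gt0. Qed.

Lemma support_nerve {d} (F : finPOrderType d) (W : {ffun F -> R}) :
  chain_weight W -> W <> [ffun=> 0] ->
  exists A : nerve F, forall x, (x \in sval A) = (W x != 0).
Proof.
move=> cW Wn0; have [x0 Wx0 _] := chain_weight_top cW Wn0; have [_ Wc] := cW.
pose S := [set x | W x != 0]%SET.
have ok : is_chain S && (0 < #|S|)%N.
  apply/andP; split; last by apply/card_gt0P; exists x0; rewrite inE.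
  apply/forall_inP => x; rewrite inE => Wx; apply/forall_inP => y; rewrite inE => Wy.
  exact: Wc.
by exists (exist (fun S => is_chain S && (0 < #|S|)%N) S ok) => x; rewrite inE.
Qed.

(** * Subdivision of a triangulation with chosen interior points as barycenters *)

Section Subdivision.
Context {d : Order.disp_t} (F : finPOrderType d) (b : nerve F -> {ffun F -> R}).
Hypothesis b_pos : forall (A : nerve F) x, x \in sval A -> 0 < b A x.
Hypothesis b_out : forall (A : nerve F) x, x \notin sval A -> b A x = 0.

(** The chain weights of [F] form a conic complex for the coordinate forms: its nonzero cells are
    the nonempty chains, and [b A] is a point in the cell of [A]. *)
Let f (x : F) (W : {ffun F -> R^o}) : R := W x.

Let f_scalar x : scalar (f x).
Proof. by move=> a v w; rewrite /f !ffunE. Qed.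

Let C : set {ffun F -> R^o} := [set W | chain_weight (W : {ffun F -> R})].

Let bV A : {ffun F -> R^o} := b A.

Let b_supp (A : nerve F) x : (0 < b A x) = (x \in sval A).
Proof. by have [/b_pos|/b_out ->] := boolP (x \in sval A); rewrite ?ltxx. Qed.

Let b_ge0 A x : 0 <= b A x.
Proof. by have [/b_pos/ltW|/b_out ->] := boolP (x \in sval A). Qed.

Let C0 : C 0.
Proof. by split=> x; rewrite !ffunE // => y; rewrite eqxx. Qed.

Let C_face v w : C w -> face f v w -> C v.
Proof.
move=> cw vw; apply: (chain_weight_sub cw) => x; have [p q] := vw x.
  by rewrite leNgt; apply/negP => /q; rewrite /f ltNge (proj1 cw x).
by rewrite !neq_lt => /orP[/q|/p] ->; rewrite ?orbT.
Qed.

Let C_pointed v : C v -> (forall i, f i v = 0) -> v = 0.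
Proof. by move=> _ v0; apply/ffunP => x; rewrite ffunE; exact: v0. Qed.

Let b_neq0E (A : nerve F) x : (b A x != 0) = (x \in sval A).
Proof. by rewrite -b_supp lt_def b_ge0 andbT. Qed.

Let bC A : C (bV A).
Proof.
by split=> [x|x y]; rewrite ?b_ge0 // !b_neq0E; exact: mem_nerve_comparable.
Qed.

Let b_neq0 A : bV A <> 0.
Proof.
move=> /ffunP b0; have /finset.set0Pn[x xA] := nerve_neq0 A.
by have := b_pos xA; have := b0 x; rewrite ffunE => ->; rewrite ltxx.
Qed.

Let b_le (A B : nerve F) : (A <= B)%O <-> face f (bV A) (bV B).
Proof.
split=> [/fintype.subsetP AB x|AB].
  rewrite /f !b_supp; split=> [/AB //|]; by rewrite ltNge b_ge0.
by apply/fintype.subsetP => x; have [+ _] := AB x; rewrite /f !b_supp.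
Qed.

Let b_onto v : C v -> v <> 0 -> exists A, face f v (bV A) /\ face f (bV A) v.
Proof.
move=> cv vn0; have [A Av] : exists A : nerve F, forall x, (x \in sval A) = (v x != 0).
  by apply: support_nerve => // v0; apply: vn0; apply/ffunP => x; rewrite v0 !ffunE.
exists A; have v0 x : (v x < 0) = false by rewrite ltNge (proj1 cv x).
have vp x : (0 < v x) = (v x != 0) by rewrite lt_def (proj1 cv x) andbT.
by split=> x; rewrite /f b_supp Av vp v0 ltNge b_ge0.
Qed.

Let comb (W : {ffun nerve F -> R}) : {ffun F -> R} := [ffun x => \sum_A W A * b A x].

Let combE (W : {ffun nerve F -> R}) : \sum_A W A *: bV A = comb W.
Proof. by apply/ffunP => x; rewrite sum_ffunE ffunE; apply: eq_bigr => A _; rewrite ffunE. Qed.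

Hypothesis b1 : forall A, \sum_x b A x = 1.

Let comb1 (W : {ffun nerve F -> R}) : \sum_x comb W x = \sum_A W A.
Proof.
under eq_bigr do rewrite ffunE; rewrite exchange_big /=.
by apply: eq_bigr => A _; rewrite -mulr_sumr b1 mulr1.
Qed.

(** The conic complex makes [comb] a bijection from the chain weights of the nerve to those of [F].
    It preserves the total weight and the point represented. *)
Lemma realizes_subdivision (g : F -> 'rV[R]_n) P : realizes g P ->
  realizes (fun A => \sum_x b A x *: g x) P.
Proof.
move=> [g_in g_onto g_inj].
have gE (W : {ffun nerve F -> R}) :
    \sum_A W A *: (\sum_x b A x *: g x) = \sum_x comb W x *: g x.
  under eq_bigr do rewrite scaler_sumr; rewrite exchange_big /=.
  apply: eq_bigr => x _; rewrite ffunE scaler_suml.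
  by apply: eq_bigr => A _; rewrite scalerA.
have cw W : chain_weight W -> chain_weight (comb W).
  by move=> cW; have := conic_comb f_scalar C0 C_face bC b_le cW; rewrite combE.
split=> [W cW W1|y Py|W W' cW cW' W1 W'1].
- by rewrite gE; apply: g_in; rewrite ?comb1 //; exact: cw.
- have [U [cU U1 ->]] := g_onto y Py.
  have [W cW UW] := conic_decomp f_scalar C_face C_pointed b_le b_onto cU.
  rewrite combE in UW.
  by exists W; split=> //; [rewrite -comb1 -UW|rewrite gE -UW].
- rewrite !gE => /g_inj eqW.
  apply: (conic_uniq f_scalar C_pointed bC b_neq0 b_le cW cW').
  by rewrite !combE; apply: eqW; rewrite ?comb1 //; exact: cw.
Qed.

(** The product of the two values expands into nonnegative multiples of products at pairs of
    vertices of the one chain [B]. *)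
Lemma compat_subdivision u (g : F -> 'rV[R]_n) : compat u g ->
  compat u (fun A => \sum_x b A x *: g x).
Proof.
move=> ug A B /fintype.subsetP AB; rewrite !homog_sum // !dot_sum mulr_suml.
apply: sumr_ge0 => x _; rewrite mulr_sumr; apply: sumr_ge0 => y _.
rewrite mulrACA; have [xA|/b_out ->] := boolP (x \in sval A); last by rewrite !mul0r.
have [yB|/b_out ->] := boolP (y \in sval B); last by rewrite mulr0 mul0r.
apply: mulr_ge0; first exact: mulr_ge0.
have /orP[xy|yx] := mem_nerve_comparable (AB _ xA) yB; first exact: ug.
by rewrite mulrC; exact: ug.
Qed.

End Subdivision.
Lemma realizes_nerve {d} (F : finPOrderType d) (g : F -> 'rV[R]_n) P u :
  realizes g P -> exists g' : nerve F -> 'rV[R]_n,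
  [/\ realizes g' P, compat u g' & forall u', compat u' g -> compat u' g'].
Proof.
move=> gP; have ex (A : nerve F) := balanced_weight (fun x => dot (homog (g x)) u) (nerve_neq0 A).
have [b bP] := choice ex.
have b_pos (A : nerve F) x : x \in sval A -> 0 < b A x by have [+ _ _ _] := bP A; exact.
have b_out (A : nerve F) x : x \notin sval A -> b A x = 0 by have [_ + _ _] := bP A; exact.
have b1 A : \sum_x b A x = 1 by have [_ _ + _] := bP A.
exists (fun A => \sum_x b A x *: g x); split.
- exact: realizes_subdivision.
- move=> A B /fintype.subsetP AB; rewrite !homog_sum // !dot_sum.
  pose l x := dot (homog (g x)) u.
  (* Either [u] takes both signs on [B] and vanishes at its barycenter, or it has one weak sign on
     all of [B], hence at the barycenters of both [A] and [B]. *)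
  have [[p [q [pB qB lp lq]]]|no] := pselect (exists p q,
      [/\ p \in sval B, q \in sval B, 0 < l p & l q < 0]).
    by have [_ _ _ /(_ p q pB qB lp lq) ->] := bP B; rewrite mulr0.
  have b_ge0 (D : nerve F) x : 0 <= b D x.
    by have [/b_pos/ltW|/b_out ->] := boolP (x \in sval D).
  have [[p pB lp]|nop] := pselect (exists2 p, p \in sval B & 0 < l p).
    have l0 x : x \in sval B -> 0 <= l x.
      by move=> xB; rewrite leNgt; apply/negP => lx; apply: no; exists p, x.
    apply: mulr_ge0; apply: sumr_ge0 => x _.
      have [/AB/l0 ?|/b_out ->] := boolP (x \in sval A); last by rewrite mul0r.
      exact: mulr_ge0.
    have [/l0 ?|/b_out ->] := boolP (x \in sval B); last by rewrite mul0r.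
    exact: mulr_ge0.
  have l0 x : x \in sval B -> l x <= 0.
    by move=> xB; rewrite leNgt; apply/negP => lx; apply: nop; exists x.
  rewrite mulr_le0 // -oppr_ge0 -sumrN; apply: sumr_ge0 => x _; rewrite -mulrN.
    have [/AB/l0 ?|/b_out ->] := boolP (x \in sval A); last by rewrite mul0r.
    by rewrite mulr_ge0 // oppr_ge0.
  have [/l0 ?|/b_out ->] := boolP (x \in sval B); last by rewrite mul0r.
  by rewrite mulr_ge0 // oppr_ge0.
- by move=> u' ug; exact: compat_subdivision.
Qed.


(** * Triangulation by the cells of a hyperplane arrangement *)

Section Cells.
Context (P : set 'rV[R]_n) (fs : seq 'rV[R]_(1 + n)).
Hypothesis fs_coord : {subset coord_forms <= fs}.
Hypothesis P_below : forall v w, below fs v w -> hcone P w -> hcone P v.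

Let f (i : 'I_(size fs)) (w : 'rV[R]_(1 + n)) : R := dot w fs`_i.

Let f_scalar i : scalar (f i).
Proof. exact: dot_scalar. Qed.

Let face_below v w : face f v w <-> below fs v w.
Proof.
split=> vw; last by move=> i; apply: vw; exact: mem_nth.
by move=> u /(nthP 0)[i ifs <-]; have := vw (Ordinal ifs).
Qed.

Let C_pointed v : hcone P v -> (forall i, f i v = 0) -> v = 0.
Proof.
move=> _ v0; apply: coord_formsP => u /fs_coord /(nthP 0)[i ifs <-].
exact: (v0 (Ordinal ifs)).
Qed.

(** With the positive and the negative indices as separate sets, the face relation becomes
    componentwise inclusion. *)
Let signs (y : 'rV[R]_n) : {set 'I_(size fs)} * {set 'I_(size fs)} :=
  ([set i | 0 < f i (homog y)]%SET, [set i | f i (homog y) < 0]%SET).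

Let cell := {p | `[< exists2 y, P y & p = signs y >]}.

Let cell_le (p q : cell) :=
  ((val p).1 \subset (val q).1) && ((val p).2 \subset (val q).2).

Let cell_refl : reflexive cell_le.
Proof. by move=> p; rewrite /cell_le !subxx. Qed.

Let cell_anti : antisymmetric cell_le.
Proof.
move=> p q /andP[/andP[pq1 pq2] /andP[qp1 qp2]]; apply: val_inj.
rewrite [val p]surjective_pairing [val q]surjective_pairing.
by congr (_, _); apply/eqP; rewrite finset.eqEsubset ?pq1 ?pq2.
Qed.

Let cell_trans : transitive cell_le.
Proof.
move=> q p r /andP[pq1 pq2] /andP[qr1 qr2].
by rewrite /cell_le (fintype.subset_trans pq1) // (fintype.subset_trans pq2).
Qed.

Let G := poset_of cell_refl cell_anti cell_trans.

Lemma realizes_cells : exists (d : Order.disp_t) (F : finPOrderType d) (g : F -> 'rV[R]_n),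
  realizes g P /\ forall u, u \in fs -> compat u g.
Proof.
have ex (p : G) : exists y, P y /\ val (p : cell) = signs y.
  by case: p => p /= /asboolP[y Py ->]; exists y.
have [g gP] := choice ex.
have g_le (p q : G) : (p <= q)%O <-> face f (homog (g p)) (homog (g q)).
  have -> : (p <= q)%O = cell_le p q by [].
  rewrite /cell_le (proj2 (gP p)) (proj2 (gP q)) /=; split=> [/andP[]|pq].
    move=> /fintype.subsetP p1 /fintype.subsetP p2 i.
    by have := (p1 i, p2 i); rewrite !inE => -[].
  by apply/andP; split; apply/fintype.subsetP => i; rewrite !inE; have [] := pq i.
have bC (p : G) : hcone P (homog (g p)) by apply/hcone_homog; have [] := gP p.
have b_neq0 (p : G) : homog (g p) <> 0.
  by move=> /rowP/(_ 0); rewrite homog0 mxE => /eqP; rewrite oner_eq0.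
have C_face v w : hcone P w -> face f v w -> hcone P v.
  by move=> wP /face_below vw; exact: P_below vw wP.
have b_onto v : hcone P v -> v <> 0 ->
    exists p, face f v (homog (g p)) /\ face f (homog (g p)) v.
  case=> // -[a a0 [y Py ->]] _.
  have yP : `[< exists2 y', P y' & signs y = signs y' >] by apply/asboolP; exists y.
  pose p : G := exist (fun p => `[< exists2 y, P y & p = signs y >]) (signs y) yP.
  exists p; have := proj2 (gP p); rewrite /= => -[/setP pos /setP neg].
  have {}pos i : (0 < f i (homog y)) = (0 < f i (homog (g p))).
    by have := pos i; rewrite !inE.
  have {}neg i : (f i (homog y) < 0) = (f i (homog (g p)) < 0).
    by have := neg i; rewrite !inE.
  by split=> i; rewrite -pos -neg /f dotZl pmulr_rgt0 // pmulr_rlt0.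
have C0 : hcone P 0 by left.
exists _, G, g; split; last first.
  move=> u /(nthP 0)[i ifs <-] p q /g_le /(_ (Ordinal ifs)); rewrite /f /= => -[pp pn].
  case: (ltrgtP 0 (dot (homog (g p)) fs`_i)) => [/[dup] /pp qp ?|/[dup] /pn qn ?|<-].
  - by rewrite mulr_ge0 // ltW.
  - by rewrite mulr_le0 // ltW.
  - by rewrite mul0r.
split=> [W cW W1|y Py|W W' cW cW' W1 W'1 eqW].
- by apply/hcone_homog; rewrite homog_sum //; exact: (conic_comb f_scalar C0 C_face bC g_le).
- have /hcone_homog Py' := Py.
  have [W cW yW] := conic_decomp f_scalar C_face C_pointed g_le b_onto Py'.
  (* The height coordinate of the combination is its total weight, and [y] sits at height one. *)
  have W1 : \sum_x W x = 1 by rewrite -(homog_sum_coord _ g) -yW homog0.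
  exists W; split=> //; move: yW; rewrite -homog_sum // => yW.
  by have [_ /(_ ltr01)] := homogZ_inj (congr1 ( *:%R 1) yW).
- apply: (conic_uniq f_scalar C_pointed bC b_neq0 g_le cW cW').
  by rewrite -!homog_sum // eqW.
Qed.

End Cells.

Lemma triangulation P (ls : seq 'rV[R]_(1 + n)) : polyhedron P ->
  exists (d : Order.disp_t) (F : finPOrderType d) (g : F -> 'rV[R]_n),
  realizes g P /\ forall u, u \in ls -> compat u g.
Proof.
move=> /polyhedron_forms[ps psP].
have ok : {subset coord_forms <= ls ++ ps ++ coord_forms}.
  by move=> u uc; rewrite !mem_cat uc !orbT.
have [|d [F [g [gP gc]]]] := @realizes_cells P _ ok.
  by move=> v w vw; apply: psP => u ups; apply: vw; rewrite !mem_cat ups orbT.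
by exists d, F, g; split=> // u uls; apply: gc; rewrite mem_cat uls.
Qed.

End Realization.

(** * Validity along the carrier map *)

(** Only the variables below this bound matter to the formula, which leaves finitely many affine
    forms to respect. *)
Fixpoint var_bound (A : formula) : nat :=
  match A with
  | Var i => i.+1
  | Bot => 0
  | And B C | Or B C | Imp B C => maxn (var_bound B) (var_bound C)
  end.

(** [Z] is a bisimulation between the topology of [P] and the order of [F]: its second condition is
    continuity, its third openness. Each serves one direction of the case of implication. *)
Lemma interp_forces (T : topologicalType) (P : set T) d (F : porderType d)
    (Z : T -> F -> Prop) (v : nat -> set T) (U : nat -> set F) (A : formula) :
  (forall x s, Z x s -> P x) ->
  (forall x s, Z x s ->
     \forall y \near x, P y -> exists2 t, (s <= t)%O & Z y t) ->
  (forall x s t, Z x s -> (s <= t)%O -> forall N, nbhs x N -> exists2 y, N y & Z y t) ->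
  (forall i x s, (i < var_bound A)%N -> Z x s -> (v i x <-> U i s)) ->
  forall x s, Z x s -> (interp P v A x <-> forces U s A).
Proof.
move=> ZP Zforth Zback; elim: A => [i|//|B IHB C IHC|B IHB C IHC|B IHB C IHC] /= vU x s Zxs;
  first exact: vU.
all: have {}IHB y t : Z y t -> (interp P v B y <-> forces U t B) by
  apply: IHB => i z r iB; apply: vU; rewrite leq_max iB.
all: have {}IHC y t : Z y t -> (interp P v C y <-> forces U t C) by
  apply: IHC => i z r iC; apply: vU; rewrite leq_max iC orbT.
- by split=> -[/(IHB _ _ Zxs) b /(IHC _ _ Zxs) c].
- by split=> -[/(IHB _ _ Zxs) b|/(IHC _ _ Zxs) c]; [left|right|left|right].
split=> [[_ xBC] t st tB|sBC].
  have [y /= yBC Zyt] := Zback _ _ _ Zxs st _ xBC.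
  case: (yBC (ZP _ _ Zyt)) => [[_ []]|yC]; first exact/(IHB _ _ Zyt).
  exact/(IHC _ _ Zyt).
split; first exact: ZP Zxs.
apply: filterS (Zforth _ _ Zxs) => y Zy Py; have [t st Zyt] := Zy Py.
have [yB|yB] := pselect (interp P v B y); last by left.
by right; apply/(IHC _ _ Zyt)/(sBC _ st)/(IHB _ _ Zyt).
Qed.

Lemma interp_sub (T : topologicalType) (P : set T) (v : nat -> set T) (A : formula) :
  (forall i, v i `<=` P) -> interp P v A `<=` P.
Proof.
move=> vP; elim: A => /= [i|//|B IHB C IHC|B IHB C IHC|B IHB C IHC] x.
- exact: vP.
- by case=> /IHB.
- by case=> [/IHB|/IHC].
- by case.
Qed.

Lemma nerve_top d (F : finPOrderType d) (A : nerve F) :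
  exists2 m, m \in sval A & forall a, a \in sval A -> (a <= m)%O.
Proof.
(* The indicator of the chain is a chain weight, whose top is the maximum. *)
pose W : {ffun F -> rat} := [ffun x => (x \in sval A)%:R].
have Wn0 x : (W x != 0) = (x \in sval A) by rewrite ffunE pnatr_eq0 eqb0 negbK.
have [|W0|m] := @chain_weight_top _ _ _ W; last 1 first.
- by rewrite Wn0 => mA top; exists m => // a; rewrite -Wn0; exact: top.
- split=> [x|x y]; first by rewrite ffunE ler0n.
  by rewrite !Wn0; exact: mem_nerve_comparable.
have /finset.set0Pn[x] := nerve_neq0 A.
by rewrite -Wn0 W0 ffunE eqxx.
Qed.

Lemma nerve_extend d (F : finPOrderType d) (A : nerve F) m :
  (forall a, a \in sval A -> (a <= m)%O) -> exists B : nerve F, sval B = m |: sval A.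
Proof.
move=> Am; pose S := m |: sval A.
have ok : is_chain S && (0 < #|S|)%N.
  apply/andP; split; last by apply/card_gt0P; exists m; rewrite setU11.
  apply/forall_inP => x /setU1P[->|xA]; apply/forall_inP => y /setU1P[->|yA].
  - by rewrite /Order.comparable lexx.
  - by rewrite /Order.comparable (Am _ yA) orbT.
  - by rewrite /Order.comparable (Am _ xA).
  - exact: mem_nerve_comparable xA yA.
by exists (exist (fun S => is_chain S && (0 < #|S|)%N) S ok).
Qed.

(** * Open and closed simplices, and the carrier of a point *)

Section Carrier.
Context {R : realType} {n : nat}.
Implicit Types (P : set 'rV[R]_n) (u : 'rV[R]_(1 + n)) (y z : 'rV[R]_n).

Lemma polyhedron_bigcup (I : finType) (p : I -> Prop) (Q : I -> set 'rV[R]_n) :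
  (forall i, polytope (Q i)) -> polyhedron [set y | exists2 i, p i & Q i y].
Proof.
move=> Qp; exists #|I|.
(* Indices outside [p] receive the empty polytope, the hull of no points. *)
exists (fun k => if `[< p (enum_val k) >] then Q (enum_val k) else set0); split.
  move=> k; case: asboolP => // _; exists [::]; apply/esym/seteqP; split=> // y.
  by move/convex_hullP/rowP/(_ 0); rewrite homog0 mxE => /eqP; rewrite oner_eq0.
apply/seteqP; split=> [y [i pi Qi]|y [k _]].
  exists (enum_rank i) => //; case: asboolP; rewrite enum_rankK //.
by case: asboolP => // pk Qk; exists (enum_val k).
Qed.

Lemma cone_weights (I : finType) (g : I -> 'rV[R]_(1 + n)) (A : {set I}) w :
  cone (map g (enum A)) w <-> exists W : {ffun I -> R},
  [/\ forall x, 0 <= W x, forall x, W x != 0 -> x \in A & w = \sum_x W x *: g x].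
Proof.
split=> [|[W [W0 WA ->]]].
  have : {subset enum A <= A} by move=> x; rewrite mem_enum.
  elim: (enum A) w => [w _ ->|v r IH w rA [t t0 /IH[x xr|W [W0 WA wE]]]].
  - exists [ffun=> 0]; split=> [x|x|]; rewrite ?ffunE ?eqxx //.
    by rewrite big1 // => x _; rewrite ffunE scale0r.
  - by apply: rA; rewrite inE xr orbT.
  exists [ffun x => W x + t * (x == v)%:R]; split=> [x|x|].
  - by rewrite ffunE addr_ge0 // mulr_ge0 // ler0n.
  - rewrite ffunE; have [-> _|_] := eqVneq x v; first by apply: rA; rewrite mem_head.
    by rewrite mulr0 addr0; exact: WA.
  under eq_bigr do rewrite ffunE scalerDl.
  rewrite big_split /= -wE (bigD1 v) //= big1 ?addr0.
    by rewrite eqxx mulr1 subrK.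
  by move=> x /negPf ->; rewrite mulr0 scale0r.
have -> : \sum_x W x *: g x = \sum_(x <- enum A) W x *: g x.
  rewrite big_enum /= [RHS]big_mkcond; apply: eq_bigr => x _.
  have [Wx|/WA ->//] := eqVneq (W x) 0.
  by rewrite Wx scale0r; case: ifP.
elim: (enum A) => [|v r IH] /=; first by rewrite big_nil.
by rewrite big_cons; exists (W v); rewrite // [X in X - _]addrC addrK.
Qed.

Context {d : Order.disp_t} {F : finPOrderType d} (g : F -> 'rV[R]_n).
Implicit Types (A B : nerve F).

Definition simplex A : set 'rV[R]_n := [set y | exists W : {ffun F -> R},
  [/\ forall x, 0 <= W x, forall x, W x != 0 -> x \in sval A, \sum_x W x = 1
    & y = \sum_x W x *: g x]].

Lemma simplex_polytope A : polytope (simplex A).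
Proof.
exists (map g (enum (sval A))); apply/seteqP; split=> y.
  move=> [W [W0 WA W1 ->]]; apply/convex_hullP; rewrite -map_comp; apply/cone_weights.
  by exists W; split=> //; rewrite homog_sum.
move/convex_hullP; rewrite -map_comp => /cone_weights[W [W0 WA yE]].
have W1 : \sum_x W x = 1 by rewrite -(homog_sum_coord W g) -yE homog0.
exists W; split=> //; move: yE; rewrite -homog_sum // => yE.
by have [_ /(_ ltr01)] := homogZ_inj (congr1 ( *:%R 1) yE).
Qed.

(** The support is exactly [A], so [y] lies in the open simplex of [A]. *)
Definition carried y A : Prop := exists W : {ffun F -> R},
  [/\ chain_weight W, \sum_x W x = 1, y = \sum_x W x *: g x
    & forall x, (x \in sval A) = (W x != 0)].

Lemma carried_simplex y A B : carried y A -> (A <= B)%O -> simplex B y.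
Proof.
move=> [W [[W0 _] W1 -> WA]] /fintype.subsetP AB.
by exists W; split=> // x; rewrite -WA; exact: AB.
Qed.

Lemma carried_inhabited A : exists y, carried y A.
Proof.
have [b [b_pos b_out b1 _]] := @balanced_weight R _ _ (fun=> 0) (nerve_neq0 A).
have bA x : (x \in sval A) = (b x != 0).
  by have [/b_pos/lt0r_neq0|/b_out ->] := boolP (x \in sval A); rewrite ?eqxx.
exists (\sum_x b x *: g x), b; split=> //; split=> [x|x y].
  by have [/b_pos/ltW|/b_out ->] := boolP (x \in sval A).
by rewrite -!bA; exact: mem_nerve_comparable.
Qed.

(** A small step from [y] towards an interior point of the simplex of [B] already lands in the open
    simplex of [B]. This is the openness of the carrier map. *)
Lemma carried_near A B y N : carried y A -> (A <= B)%O -> nbhs y N ->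
  exists2 z, N z & carried z B.
Proof.
move=> [W [[W0 _] W1 yE WA]] /fintype.subsetP AB Ny.
have [z [U [[U0 _] U1 zE UB]]] := carried_inhabited B.
have [e /andP[e0 e1] Ne] := near_segment z Ny.
exists ((1 - e) *: y + e *: z) => //.
exists [ffun x => (1 - e) * W x + e * U x].
have V0 x : 0 <= (1 - e) * W x + e * U x.
  by rewrite addr_ge0 // mulr_ge0 // ?subr_ge0 ltW.
have VB x : (x \in sval B) = ((1 - e) * W x + e * U x != 0).
  have [xB|xB] := boolP (x \in sval B).
    apply/esym/lt0r_neq0; apply: ltr_wpDl; first by rewrite mulr_ge0 // subr_ge0 ltW.
    by rewrite mulr_gt0 // lt_def U0 andbT -UB.
  have /eqP -> : U x == 0 by rewrite -[_ == _]negbK -UB.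
  have /eqP -> : W x == 0.
    by rewrite -[_ == _]negbK -WA; apply: contra xB; exact: AB.
  by rewrite !mulr0 addr0 eqxx.
split.
- split=> [x|x x']; first by rewrite ffunE.
  by rewrite !ffunE -!VB; exact: mem_nerve_comparable.
- under eq_bigr do rewrite ffunE.
  by rewrite big_split /= -!mulr_sumr W1 U1 !mulr1 subrK.
- rewrite yE zE !scaler_sumr -big_split /=; apply: eq_bigr => x _.
  by rewrite !scalerA -scalerDl ffunE.
- by move=> x; rewrite ffunE VB.
Qed.

(** The form is positive at some vertex of [A]; by compatibility it is then nonnegative at every
    vertex of [B], where that vertex has positive weight. *)
Lemma compat_below u A B y z : compat u g -> carried y A -> carried z B -> (A <= B)%O ->
  0 < dot (homog y) u -> 0 < dot (homog z) u.
Proof.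
move=> ug [W [[W0 _] W1 -> WA]] [U [[U0 _] U1 -> UB]] /fintype.subsetP AB.
rewrite !homog_sum // !dot_sum => pos.
have [a aA ua] : exists2 a, a \in sval A & 0 < dot (homog (g a)) u.
  apply: contrapT => no; move: pos; rewrite ltNge => /negP; apply.
  rewrite -oppr_ge0 -sumrN; apply: sumr_ge0 => x _; rewrite -mulrN.
  have [->|Wx] := eqVneq (W x) 0; first by rewrite mul0r.
  rewrite mulr_ge0 // oppr_ge0 leNgt; apply/negP => ux; apply: no.
  by exists x; rewrite // WA.
have u0 b : b \in sval B -> 0 <= dot (homog (g b)) u.
  move=> bB; rewrite -(pmulr_rge0 _ ua).
  by have /orP[/ug //|/ug] := mem_nerve_comparable (AB _ aA) bB; rewrite mulrC.
rewrite (bigD1 a) //= ltr_pwDl //.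
  by rewrite mulr_gt0 // lt_def U0 -UB AB.
apply: sumr_ge0 => x _; have [->|Ux] := eqVneq (U x) 0; first by rewrite mul0r.
by rewrite mulr_ge0 // u0 // UB.
Qed.

Context {P : set 'rV[R]_n}.
Hypothesis gP : realizes g P.

Lemma carried_in y A : carried y A -> P y.
Proof. by have [+ _ _] := gP => g_in [W [cW W1 -> _]]; exact: g_in. Qed.

Lemma carried_ex y : P y -> exists A, carried y A.
Proof.
have [_ + _] := gP => /[apply] -[W [cW W1 yE]].
have [|A AW] := support_nerve cW.
  move=> W0; have /eqP := W1; rewrite big1 ?(eq_sym 0) ?oner_eq0 // => x _.
  by rewrite W0 ffunE.
by exists A, W.
Qed.

Lemma simplex_carried y A B : carried y A -> simplex B y -> (A <= B)%O.
Proof.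
have [_ _ g_inj] := gP.
move=> [W [cW W1 -> WA]] [U [U0 UB U1 eqU]]; apply/fintype.subsetP => x.
rewrite WA (g_inj W U) //; first exact: UB.
split=> // a b /UB aB /UB; exact: mem_nerve_comparable aB.
Qed.

Lemma simplex_sub A : simplex A `<=` P.
Proof.
have [g_in _ _] := gP => y [W [W0 WA W1 ->]]; apply: g_in => //; split=> // a b.
by move=> /WA aA /WA; exact: mem_nerve_comparable aA.
Qed.

(** The open star of [A] is a neighborhood of [y] in [P]: each of the finitely many closed simplices
    that miss [y] stays away from it. This is the continuity of the carrier map. *)
Lemma carried_open y A : carried y A ->
  \forall z \near y, P z -> exists2 B, (A <= B)%O & carried z B.
Proof.
move=> yA.
have far B : \forall z \near y, simplex B z -> (A <= B)%O.
  have [ls lsP] : exists ls, forall v w, below ls v w -> hcone (simplex B) w ->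
      hcone (simplex B) v.
    apply: polyhedron_forms; exists 1, (fun=> simplex B); split.
      by move=> _; exact: simplex_polytope.
    by apply/seteqP; split=> [z zB|z []//]; exists ord0.
  apply: filterS (near_below ls y) => z /lsP yz /hcone_homog /yz /hcone_homog.
  exact: simplex_carried.
have all_far : \forall z \near y, forall B, simplex B z -> (A <= B)%O.
  exact: (filter_forall (f := fun B z => simplex B z -> (A <= B)%O) _ far).
apply: filterS all_far => z zfar /carried_ex[B zB].
by exists B => //; apply: zfar; exact: carried_simplex zB (lexx _).
Qed.

Lemma realizes_polyhedron : polyhedron P.
Proof.
rewrite (_ : P = [set y | exists2 A, True & simplex A y]).
  by apply: polyhedron_bigcup => A; exact: simplex_polytope.
apply/seteqP; split=> [y /carried_ex[A yA]|y [A _ /simplex_sub //]].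
by exists A => //; exact: carried_simplex yA (lexx _).
Qed.

End Carrier.

(** * Transfer of validity between a polyhedron and the posets triangulating it *)

Section Transfer.
Context {R : realType} {n : nat} {P : set 'rV[R]_n}.
Context {d : Order.disp_t} {F : finPOrderType d} {g : F -> 'rV[R]_n}.
Hypothesis gP : realizes g P.

Lemma carried_uniq y (A B : nerve F) : carried g y A -> carried g y B -> A = B.
Proof.
move=> yA yB; apply: le_anti; apply/andP; split.
  exact: (simplex_carried gP yA (carried_simplex yB (lexx B))).
exact: (simplex_carried gP yB (carried_simplex yA (lexx A))).
Qed.

(** The carrier map followed by the maximum map from the nerve to [F], as a relation. *)
Let Z y (m : F) : Prop := exists A : nerve F,
  [/\ carried g y A, m \in sval A & forall a, a \in sval A -> (a <= m)%O].

Let Z_uniq y m m' : Z y m -> Z y m' -> m = m'.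
Proof.
move=> [A [yA mA Am]] [B [yB mB Bm]]; rewrite (carried_uniq yB yA) in mB Bm.
by apply: le_anti; rewrite Bm // Am.
Qed.

(** A valuation of [F] is pulled back along [Z], and its value at [s] is read off at a point carried
    by the one-element chain of [s]. *)
Lemma frame_valid_polyhedron (A : formula) : polyhedron_valid P A -> frame_valid F A.
Proof.
move=> PA U Uup s.
pose v i : set 'rV[R]_n := [set y | exists2 m, Z y m & U i m].
have [s1 s1E] : exists B : nerve F, sval B = [set s]%SET.
  have ok : is_chain [set s]%SET && (0 < #|[set s]%SET|)%N.
    rewrite cards1 andbT; apply/forall_inP => x /set1P ->; apply/forall_inP => y /set1P ->.
    by rewrite /Order.comparable lexx.
  by exists (exist (fun S => is_chain S && (0 < #|S|)%N) _ ok).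
have [y ys] := carried_inhabited g s1.
have Zys : Z y s.
  by exists s1; split=> //; rewrite s1E ?set11 // => a /set1P ->.
have vE i x m : Z x m -> (v i x <-> U i m).
  by move=> xm; split=> [[m' /(Z_uniq xm) <-]|]; last by exists m.
have v_open i : open_subpolyhedron P (v i).
  (* As [U i] is upward closed, the maximum of a chain misses it exactly when the whole chain does;
     the complement of [v i] is thus a union of closed simplices. *)
  pose Q := [set y | exists2 B : nerve F, (forall a, a \in sval B -> ~ U i a) & simplex g B y].
  exists Q.
    split; first by move=> x [B _]; exact: simplex_sub.
    by apply: polyhedron_bigcup => B; exact: simplex_polytope.
  apply/seteqP; split=> [x [m [B [xB mB Bm]] Um]|x [Px xQ]].
    split; first exact: (carried_in gP xB).
    move=> [D DU /(simplex_carried gP xB) /fintype.subsetP BD].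
    exact: (DU m) (BD _ mB) Um.
  have [B xB] := carried_ex gP Px; have [m mB Bm] := nerve_top B.
  exists m; first by exists B.
  apply: contrapT => Um; apply: xQ; exists B; last exact: carried_simplex xB (lexx _).
  by move=> a /Bm am Ua; apply: Um; exact: Uup am Ua.
apply/(@interp_forces _ P _ F Z v U A _ _ _ _ y s Zys).
- by move=> x m [B [xB _ _]]; exact: (carried_in gP xB).
- move=> x m [B [xB mB _]]; apply: filterS (carried_open gP xB) => z Pz /Pz.
  move=> [D /fintype.subsetP BD zD]; have [m' m'D Dm'] := nerve_top D.
  by exists m'; [exact/Dm'/BD|exists D].
- move=> x m m' [B [xB mB Bm]] mm' N Nx.
  (* Adjoining [m'] to the chain makes it the new maximum. *)
  have [D DE] : exists D : nerve F, sval D = m' |: sval B.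
    by apply: nerve_extend => a /Bm am; exact: le_trans mm'.
  have BD : (B <= D)%O by apply/fintype.subsetP => a aB; rewrite DE setU1r.
  have [z Nz zD] := carried_near xB BD Nx; exists z => //; exists D.
  split=> //; rewrite DE ?setU11 // => a /setU1P[->//|/Bm am].
  exact: le_trans mm'.
- by move=> i x m _; exact: vE.
rewrite (PA v v_open); have [B [yB _ _]] := Zys; exact: (carried_in gP yB).
Qed.

(** Compatible forms have constant signs on open simplices, so [v] is constant there and comes from
    a valuation of the nerve along the carrier map. *)
Lemma interp_nerve (A : formula) (v : nat -> set 'rV[R]_n) (ls : seq 'rV[R]_(1 + n)) :
  (forall u, u \in ls -> compat u g) -> (forall i, v i `<=` P) ->
  (forall i y z, (i < var_bound A)%N -> below ls (homog y) (homog z) ->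
     P z -> v i y -> v i z) ->
  frame_valid (nerve F) A -> interp P v A = P.
Proof.
move=> lsg vP v_below FA.
(* Nothing is known of [v i] beyond the bound; [U i] is made empty there so that it stays upward
   closed. *)
pose U i : set (nerve F) :=
  [set B | (i < var_bound A)%N /\ exists2 y, carried g y B & v i y].
have lt_below y z (B D : nerve F) : carried g y B -> carried g z D -> (B <= D)%O ->
    below ls (homog y) (homog z).
  move=> yB zD BD u /lsg ug; split; first exact: compat_below ug yB zD BD.
  (* Negative signs are handled by the opposite form, which is compatible too. *)
  rewrite -![_ < 0]oppr_gt0 -!dotNr.
  apply: compat_below yB zD BD => s t /ug.
  by rewrite !dotNr mulrNN.
have Uup i : upward_closed (U i).
  move=> B D BD [iA [y yB vy]]; split=> //; have [z zD] := carried_inhabited g D.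
  exists z => //; apply: v_below vy => //; first exact: lt_below yB zD BD.
  exact: (carried_in gP zD).
apply/seteqP; split; first exact: interp_sub.
move=> y Py; have [B yB] := carried_ex gP Py.
apply/(@interp_forces _ P _ (nerve F) (carried g) v U A _ _ _ _ y B yB).
- by move=> x D; exact: carried_in.
- by move=> x D; exact: carried_open.
- by move=> x D D' xD DD' N; exact: carried_near xD DD'.
- move=> i x D iA xD; split=> [vx|[_ [z zD vz]]]; first by split=> //; exists x.
  by apply: v_below vz => //; [exact: lt_below zD xD (lexx _)|exact: carried_in xD].
exact: FA.
Qed.

End Transfer.

(** * Reduction of valuations to finitely many forms, and the criterion *)

Lemma valuation_forms (R : realType) (n : nat) (P : set 'rV[R]_n) (v : nat -> set 'rV[R]_n)
    (k : nat) : (forall i, open_subpolyhedron P (v i)) ->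
  exists ls : seq 'rV[R]_(1 + n), forall i y z, (i < k)%N ->
    below ls (homog y) (homog z) -> P z -> v i y -> v i z.
Proof.
move=> vo.
have ex i : exists ls : seq 'rV[R]_(1 + n), forall y z,
    below ls (homog y) (homog z) -> P z -> v i y -> v i z.
  have [Q [_ /polyhedron_forms[ls lsQ]] ->] := vo i.
  exists ls => y z yz Pz [Py yQ]; split=> // zQ; apply/yQ/hcone_homog.
  by apply: lsQ yz _; apply/hcone_homog.
have [ls lsP] := choice ex.
exists (flatten [seq ls i | i <- iota 0 k]) => i y z ik yz; apply: lsP => u ui.
by apply: yz; apply/flattenP; exists (ls i) => //; rewrite map_f // mem_iota.
Qed.

(** One nerve is taken per form of the list; later subdivisions preserve the compatibility already
    reached. *)
Lemma nerve_closed_refine (R : realType) (n : nat) (D : finposet_class) (P : set 'rV[R]_n)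
    (ls : seq 'rV[R]_(1 + n)) : nerve_closed D ->
  forall (d : Order.disp_t) (F : finPOrderType d) (g : F -> 'rV[R]_n),
  D d F -> realizes g P ->
  exists (d' : Order.disp_t) (F' : finPOrderType d') (g' : F' -> 'rV[R]_n),
  [/\ D d' F', realizes g' P, forall u, compat u g -> compat u g'
    & forall u, u \in ls -> compat u g'].
Proof.
move=> Dn; elim: ls => [|u ls IH] d F g DF gP; first by exists d, F, g.
have [g1 [g1P ug1 gg1]] := realizes_nerve u gP.
have [d' [F' [g' [DF' g'P g1g' lsg']]]] := IH _ _ _ (Dn _ _ DF) g1P.
exists d', F', g'; split=> // w; first by move=> /gg1/g1g'.
by rewrite inE => /predU1P[->|/lsg' //]; exact: g1g'.
Qed.

Theorem theorem4p1 (R : realType) (L : set formula) (hL : intermediate_logic L) :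
  polyhedrally_complete R L <->
  exists D : finposet_class, nerve_closed D /\ L = logic_of_finposets D.
Proof.
split=> [[C Cpoly LC]|[D [Dn LD]]].
  (* The class of posets triangulating some member of [C]; subdivision makes it closed under
     nerves. *)
  exists (fun (d : Order.disp_t) (F : finPOrderType d) =>
    exists n (P : set 'rV[R]_n) (g : F -> 'rV[R]_n), C n P /\ realizes g P).
  split=> [d F [n [P [g [CP gP]]]]|].
    by have [g' [g'P _ _]] := realizes_nerve 0 gP; exists n, P, g'.
  apply/seteqP; split=> A.
    rewrite LC => LA d F [n [P [g [CP gP]]]].
    exact: (frame_valid_polyhedron gP (LA _ _ CP)).
  move=> DA; rewrite LC => n P CP v vo.
  have [ls lsv] := valuation_forms (var_bound A) vo.
  (* Here the forms of the valuation are put into the arrangement from the start, and one nerve of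
     the resulting poset suffices. *)
  have [d [F [g [gP lsg]]]] := triangulation ls (Cpoly _ _ CP).
  apply: (interp_nerve gP lsg _ lsv); first by move=> i; have [Q _ ->] := vo i; move=> y [].
  have [g' [g'P _ _]] := realizes_nerve 0 gP.
  by apply: DA; exists n, P, g'.
(* The largest possible class is taken: all polyhedra validating [L]. It remains to show that it
   contains a polyhedron triangulated by each [F] in [D]. *)
exists (fun n P => polyhedron P /\ forall A, L A -> polyhedron_valid P A).
  by move=> n P [].
apply/seteqP; split=> [A LA n P [_ PL]|A LA]; first exact: PL.
rewrite LD => d F DF.
(* The elements of [F] become the standard basis vectors; their linear independence makes the
   realization injective. *)
pose g (x : F) : 'rV[R]_#|F| := delta_mx 0 (enum_rank x).
have gE (W : F -> R) x : (\sum_x W x *: g x) 0 (enum_rank x) = W x.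
  rewrite summxE (bigD1 x) //= !mxE !eqxx mulr1 big1 ?addr0 // => y yx.
  by rewrite !mxE (inj_eq enum_rank_inj) eq_sym (negPf yx) mulr0.
have g_free (W W' : F -> R) : \sum_x W x *: g x = \sum_x W' x *: g x -> W =1 W'.
  by move=> eqW x; rewrite -(gE W) eqW gE.
have gP := realizes_standard g_free.
apply: (frame_valid_polyhedron gP); apply: LA; split; first exact: realizes_polyhedron gP.
move=> B LB v vo; have [ls lsv] := valuation_forms (var_bound B) vo.
(* Iterated nerves of [F] stay in [D], hence validate [L], and reach compatibility with the forms of
   the valuation. *)
have [d' [F' [g' [DF' g'P _ lsg']]]] := nerve_closed_refine ls Dn DF gP.
apply: (interp_nerve g'P lsg' _ lsv); first by move=> i; have [Q _ ->] := vo i; move=> y [].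
by move: LB; rewrite LD; apply; exact: Dn.
Qed.
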